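(* The infimum of $SX(A,B)$, taken over all pairs $(A,B)$ of perfect additive complements, equals $\sqrt[4]{4.5}$.
   Context: Two sets $A,B$ of nonnegative integers are called perfect additive complements if every nonnegative integer can be expressed in exactly one way as $a+b$ with $a\in A$, $b\in B$. For a set $A$ of nonnegative integers, $A(x)$ denotes the number of elements $a\in A$ with $a\le x$, and $SX(A,B)=\limsup_{x\to\infty}\frac{\max\{A(x),B(x)\}}{\sqrt x}$. *)

(* Defs.v *)
From HB Require Import structures.
From mathcomp Require Import all_boot all_order all_algebra finmap.
From mathcomp Require Import all_classical all_reals all_analysis.

Set Implicit Arguments.
Unset Strict Implicit.
Unset Printing Implicit Defensive.

Import Order.TTheory GRing.Theory Num.Theory.
Import numFieldNormedType.Exports.

Local Open Scope classical_set_scope.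
Local Open Scope ring_scope.

Definition perfect_additive_complements (A B : set nat) : Prop :=
  forall n : nat, exists! p : nat * nat,
    [/\ A p.1, B p.2 & n = (p.1 + p.2)%N].

(* [fset_set] is only meaningful on finite sets; the set below is finite
   since all its elements are at most x. *)
Definition counting_function (R : realType) (A : set nat) (x : R) : nat :=
  #|` fset_set [set a : nat | A a /\ a%:R <= x] |.

(* Valued in the extended reals because the limsup may be infinite, for
   instance when A is the set of all naturals and B = {0}. *)
Definition SX (R : realType) (A B : set nat) : \bar R :=
  limf_esup
    (fun x : R =>
       ((maxn (counting_function A x) (counting_function B x))%:R
          / Num.sqrt x)%:E)
    (pinfty_nbhs R).

(* Main.v *)
(** De Bruijn's structure theorem: if [1 \in A] and [B <> {0}], and [m] is the
    least positive element of [B], then [A = {0..m-1} + m A'] and [B = m B'] for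
    perfect complements [A'], [B'] with [1 \in B'].  Iterating, one reaches levels
    [M] at which the elements below [M] number [a] in [A] and [b] in [B], with
    maxima [al] and [be], where [a b = M] and [al + be = M - 1].  Then
    [(a^2 / al) (b^2 / be) = M^2 / (al be)], which is at least [9 / 2] as soon as
    one of [al], [be] is at most [M / 3]; among two consecutive levels one has
    this property.  Hence [max^4 / x^2 >= 9 / 2] for arbitrarily large [x].
    Conversely, for the numbers with binary digits in even, respectively odd,
    positions the two limits superior of [A(x)^2 / x] and [B(x)^2 / x] are [3] and
    [3 / 2]; prepending two digits in bases [p] and [q] turns them into [3 p / q]
    and [3 q / (2 p)], which are balanced by letting [p / q] approach
    [1 / sqrt 2]. *)

Require Import Defs.
From HB Require Import structures.
From mathcomp Require Import all_boot all_order all_algebra finmap zify ring lra.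
From mathcomp Require Import all_classical all_reals all_analysis.

Set Implicit Arguments.
Unset Strict Implicit.
Unset Printing Implicit Defensive.

Import Order.TTheory GRing.Theory Num.Theory.
Import numFieldNormedType.Exports.

Local Open Scope classical_set_scope.
Local Open Scope nat_scope.

(** * Perfect complements and prepending a digit *)

Definition unique_sum (A B : set nat) (n : nat) : Prop :=
  exists! p : nat * nat, [/\ A p.1, B p.2 & n = p.1 + p.2].

Definition block_expand (m : nat) (A : set nat) : set nat := [set n | A (n %/ m)].

Definition dilate (m : nat) (B : set nat) : set nat :=
  [set n | m %| n /\ B (n %/ m)].

Lemma unique_sumC A B n : unique_sum A B n -> unique_sum B A n.
Proof.
move=> [[a b] /= [[Aa Bb nE] U]]; exists (b, a); split=> /=.
  by split=> //; rewrite addnC.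
move=> [b' a'] /= [Bb' Aa' nE'].
by have [] : (a, b) = (a', b') by [apply: U; split=> //=; rewrite addnC]; move=> -> ->.
Qed.

Lemma perfect_sym A B :
  perfect_additive_complements A B -> perfect_additive_complements B A.
Proof. by move=> AB n; apply/unique_sumC/AB. Qed.

(** Kept pointwise in [n], so that a self-similar pair can be treated by induction on [n]. The
    residue of [n] modulo [m] can only come from the first summand. *)
Lemma unique_sum_expand m A B n : 0 < m ->
  unique_sum A B (n %/ m) -> unique_sum (block_expand m A) (dilate m B) n.
Proof.
move=> m0 [[a b] /= [[Aa Bb nE] U]].
exists (a * m + n %% m, b * m); split=> /=.
  split; first by rewrite /block_expand/= divnMDl// divn_small ?addn0// ltn_mod.
    by rewrite /dilate/= dvdn_mull// mulnK.
  by rewrite {1}(divn_eq n m) nE mulnDl addnAC.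
move=> [a' b'] /= [Aa' [/dvdnP[k kE] Bk] nE'].
rewrite kE mulnK// in Bk; subst b'.
have [-> ->] : (a, b) = (a' %/ m, k).
  by apply: U; split=> //=; rewrite nE' addnC divnMDl// addnC.
 congr pair.
by rewrite nE' [a' + _]addnC modnMDl -divn_eq.
Qed.

Lemma perfect_expand m A B : 0 < m -> perfect_additive_complements A B ->
  perfect_additive_complements (block_expand m A) (dilate m B).
Proof. by move=> m0 AB n; apply: unique_sum_expand => //; apply: AB. Qed.

Lemma perfect_uniq A B a b a' b' : perfect_additive_complements A B ->
  A a -> B b -> A a' -> B b' -> a + b = a' + b' -> a = a' /\ b = b'.
Proof.
move=> AB Aa Bb Aa' Bb' e; have [p [_ U]] := AB (a + b).
have := U (a, b) (And3 Aa Bb erefl).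
by have := U (a', b') (And3 Aa' Bb' e) => -> [-> ->].
Qed.

Lemma perfect_rep A B n : perfect_additive_complements A B ->
  exists a b, [/\ A a, B b & n = a + b].
Proof. by move=> AB; have [[a b] [? _]] := AB n; exists a, b. Qed.

Lemma perfect0 A B : perfect_additive_complements A B -> A 0 /\ B 0.
Proof.
move=> AB; have [a [b [Aa Bb e]]] := perfect_rep 0 AB.
have -> : 0 = a by lia.
by split=> //; have -> : a = b by lia.
Qed.

(** The structure of perfect complements *)

(** Strong induction on [n = k * m + i]. For [i > 0], the representation [k * m = a + b] decides the
    fate of the block: it lies in [A] if [b = 0] and misses [A] if [b > 0]. *)
Lemma perfect_block_rigid A B m n : perfect_additive_complements A B ->
  0 < m -> B m -> (forall b, 0 < b -> B b -> m <= b) ->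
  (B n -> m %| n) /\ (A n <-> A (n %/ m * m)).
Proof.
move=> AB m_gt0 Bm m_min.
have ltm_memA i : i < m -> A i.
  move=> im; have [a [b [Aa Bb e]]] := perfect_rep i AB.
  have [b0|b0] := posnP b; first by have -> : i = a by lia.
  by have := m_min b b0 Bb; lia.
have [A0 B0] := perfect0 AB.
elim/ltn_ind: n => n IH.
have [i0|i0] := posnP (n %% m).
  have e : n %/ m * m = n by rewrite {2}(divn_eq n m) i0 addn0.
  by rewrite e; split=> // _; apply/eqP.
have im : n %% m < m by rewrite ltn_mod.
have nE := divn_eq n m.
set k := n %/ m in nE *; set i := n %% m in nE im i0 *.
have [a [b [Aa Bb e]]] := perfect_rep (k * m) AB.
have [b0|b0] := posnP b.
  have Ak : A (k * m) by have -> : k * m = a by lia.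
  have nBn : ~ B n.
    (* Here [k * m + m = (m - i) + n] would be two representations. *)
    move=> Bn; have Ami : A (m - i) by apply: ltm_memA; lia.
    have [] := perfect_uniq AB Ak Bm Ami Bn; first by lia.
    by case: (k) => [|k']; rewrite ?mulSn; lia.
  suff An : A n by split.
  have [a' [b' [Aa' Bb' e']]] := perfect_rep n AB.
  have [b'0|b'0] := posnP b'; first by have -> : n = a' by lia.
  have [a'0|a'0] := posnP a'.
    by case: nBn; have -> : n = b' by lia.
  (* By induction [m] divides [b'], and [a'] rounded down to a multiple of [m] stays in [A]: a
     second representation of [k * m]. *)
  have /IH[/(_ Bb')/dvdnP[l lE] _] : b' < n by lia.
  have /IH[_ [/(_ Aa') Aa'' _]] : a' < n by lia.
  have a'E : a' %% m = i by rewrite /i e' lE addnC modnMDl.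
  have a'D := divn_eq a' m.
  by have [] := perfect_uniq AB Ak B0 Aa'' Bb'; lia.
have bn : b < n by lia.
have [/(_ Bb)/dvdnP[l lE] _] := IH _ bn.
have aE : a = (k - l) * m by rewrite mulnBl; lia.
(* Once [a + i] is in [A], the sum [n = (a + i) + b] has two positive terms, so [n] is in neither
   set. *)
have /IH[_ [_ Aai]] : a + i < n by lia.
have {}Aai : A (a + i).
  by apply: Aai; rewrite aE divnMDl// divn_small// addn0 -aE.
split.
  by move=> Bn; have [] := perfect_uniq AB Aai Bb A0 Bn; lia.
split.
  by move=> An; have [] := perfect_uniq AB Aai Bb An B0; lia.
by move=> An; have [] := perfect_uniq AB Aa Bb An B0; lia.
Qed.

(** The conclusion [B' 1] allows a further application with the roles of the two sets exchanged. *)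
Lemma perfect_decomp A B : perfect_additive_complements A B -> A 1 ->
  (forall n, A n) \/
  exists m A' B', [/\ 1 < m, perfect_additive_complements A' B', B' 1,
    A = block_expand m A' & B = dilate m B'].
Proof.
move=> AB A1; have [A0 B0] := perfect0 AB.
have [[b Bb]|nB] := pselect (exists b, `[< 0 < b /\ B b >]); last first.
  left=> n; have [a [b [Aa Bb e]]] := perfect_rep n AB.
  have [b0|b0] := posnP b; first by have -> : n = a by lia.
  by case: nB; exists b; apply/asboolP.
right; have ex : exists b, `[< 0 < b /\ B b >] by exists b.
case: (ex_minnP ex) => m /asboolP[m0 Bm] m_min.
have {}m_min b' : 0 < b' -> B b' -> m <= b' by move=> *; apply/m_min/asboolP.
have blk n := perfect_block_rigid n AB m0 Bm m_min.
(* Otherwise [1 = 1 + 0 = 0 + 1]. *)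
have m1 : 1 < m.
  rewrite ltn_neqAle m0 andbT; apply/eqP => e; rewrite -e in Bm.
  by have [] := perfect_uniq AB A1 B0 A0 Bm.
exists m, [set k | A (k * m)], [set k | B (k * m)]; split=> //=.
- move=> n; have [a [b' [Aa Bb' e]]] := perfect_rep (n * m) AB.
  have [/(_ Bb')/dvdnP[l lE] _] := blk b'.
  have aE : a = (n - l) * m by rewrite mulnBl; lia.
  exists (n - l, l); split=> /=.
    split; [by rewrite -aE|by rewrite -lE|].
    by apply/eqP; rewrite -(eqn_pmul2r m0) mulnDl; apply/eqP; lia.
  move=> [x y] /= [Ax By xy].
  have [] := perfect_uniq AB Aa Bb' Ax By; first by rewrite -e xy; lia.
  rewrite aE lE => /eqP; rewrite eqn_pmul2r// => /eqP -> /eqP.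
  by rewrite eqn_pmul2r// => /eqP ->.
- by rewrite mul1n.
- by apply/seteqP; split=> n; rewrite /block_expand/=; have [_ []] := blk n.
- apply/seteqP; split=> n; rewrite /dilate/=.
    by move=> Bn; have [/(_ Bn) mn _] := blk n; rewrite divnK.
  by move=> [mn]; rewrite divnK.
Qed.

(** Counting elements up to [n] *)

(** A sum in [nat], suited to induction on [n]; [counting_functionE] links it to
    [counting_function]. *)
Definition cnt (A : set nat) (n : nat) : nat := \sum_(i < n.+1) `[< A i >].

Lemma cntS A n : cnt A n.+1 = cnt A n + `[< A n.+1 >].
Proof. by rewrite /cnt big_ord_recr. Qed.

Lemma cnt0 A : cnt A 0 = `[< A 0 >].
Proof. by rewrite /cnt big_ord1. Qed.

Lemma cnt_gt0 A n : A 0 -> 0 < cnt A n.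
Proof.
move=> A0; elim: n => [|n IH]; first by rewrite cnt0 asboolT.
by rewrite cntS addn_gt0 IH.
Qed.

Lemma cntT A n : (forall k, A k) -> cnt A n = n.+1.
Proof.
by move=> AT; elim: n => [|n IH]; rewrite ?cnt0 ?cntS ?IH asboolT// addn1.
Qed.

Lemma leq_cnt A n n' : n <= n' -> cnt A n <= cnt A n'.
Proof.
move=> /subnK <-; elim: (n' - n) => // k IH.
by rewrite addSn cntS (leq_trans IH)// leq_addr.
Qed.

Lemma cnt_expand_block m A k : 0 < m ->
  cnt (block_expand m A) (k * m + m.-1) = m * cnt A k.
Proof.
move=> m0; have blk j l : l < m ->
    \sum_(i < l.+1) `[< block_expand m A (j * m + i) >] = l.+1 * `[< A j >].
  move=> lm; rewrite (eq_bigr (fun=> nat_of_bool `[< A j >])).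
    by rewrite sum_nat_const card_ord.
  move=> i _; rewrite /block_expand/= divnMDl// divn_small ?addn0//.
  by have := ltn_ord i; lia.
elim: k => [|k IH].
  rewrite mul0n add0n cnt0 -[in RHS](prednK m0) -blk; last by lia.
  by rewrite /cnt; apply: eq_bigr.
have -> : cnt (block_expand m A) (k.+1 * m + m.-1) =
    cnt (block_expand m A) (k * m + m.-1) +
    \sum_(i < m.-1.+1) `[< block_expand m A (k.+1 * m + i) >].
  rewrite /cnt -!(big_mkord xpredT (fun i => nat_of_bool `[< block_expand m A i >])).
  rewrite (@big_cat_nat _ _ _ (k * m + m.-1).+1)//=; last by lia.
  congr addn.
  rewrite -(big_mkord xpredT (fun i =>
    nat_of_bool `[< block_expand m A (k.+1 * m + i) >])).
  rewrite -{1}[(k * m + m.-1).+1]add0n big_addn.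
  have -> : (k.+1 * m + m.-1).+1 - (k * m + m.-1).+1 = m.-1.+1 by lia.
  apply: eq_bigr => i _; congr (nat_of_bool (asbool (block_expand m A _))); lia.
by rewrite IH blk ?ltn_predL// cntS mulnDr prednK.
Qed.

Lemma cnt_expand_le m A n : 0 < m -> cnt (block_expand m A) n <= m * cnt A (n %/ m).
Proof.
move=> m0; rewrite -cnt_expand_block//; apply: leq_cnt.
have := divn_eq n m; have : n %% m < m by rewrite ltn_mod.
lia.
Qed.

Lemma cnt_dilate m B n : 0 < m -> cnt (dilate m B) n = cnt B (n %/ m).
Proof.
move=> m0; elim: n => [|n IH].
  rewrite div0n !cnt0 /dilate/= dvdn0 div0n.
  by congr nat_of_bool; apply: asbool_equiv_eq; split=> [[]|].
rewrite cntS IH divnS//; have [mn|mn] := boolP (m %| n.+1).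
  rewrite add1n cntS; congr addn; congr nat_of_bool.
  apply: asbool_equiv_eq; rewrite /dilate/= divnS// mn add1n.
  by split=> [[]|].
by rewrite asboolF ?addn0// => -[]; rewrite (negPf mn).
Qed.

(** The lower bound *)

(* [A = A0 + M A'] and [B = B0 + M B'] where [A0] and [B0] are complements in
   [0, M), with [a], [b] elements and maxima [al], [be]; only the resulting
   lower bounds on the counting functions are recorded.  The next digit belongs
   to the first set. *)
Record level (A B : set nat) (M a b al be : nat) (A' B' : set nat) : Prop :=
  Level {
    level_perfect : perfect_additive_complements A' B';
    level_mem1 : A' 1;
    level_size : a * b = M;
    level_max : (al + be).+1 = M;
    level_cntl : forall y, a * cnt A' y <= cnt A (al + y * M);
    level_cntr : forall y, b * cnt B' y <= cnt B (be + y * M) }.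

(** The ratio in [SX] is at least the fourth root of 9/2 at [n], with the fourth power taken and
    denominators cleared. *)
Definition dense_at (A B : set nat) (n : nat) : Prop :=
  9 * n ^ 2 <= 2 * maxn (cnt A n) (cnt B n) ^ 4.

Lemma dense_atC A B n : dense_at A B n -> dense_at B A n.
Proof. by rewrite /dense_at maxnC. Qed.

Lemma dense_atl A B n a : a <= cnt A n -> 9 * n ^ 2 <= 2 * a ^ 4 ->
  dense_at A B n.
Proof.
move=> an h; apply: leq_trans h _; rewrite leq_mul2l/= leq_exp2r//.
by rewrite (leq_trans an)// leq_maxl.
Qed.

Lemma level_full A B M a b al be A' B' X : level A B M a b al be A' B' ->
  (forall n, A' n) -> exists2 n, X < n & dense_at A B n.
Proof.
(* Growth is now linear: [n <= M * y.+1] and [3 * M <= y.+1] give [9 * n ^ 2 <= y.+1 ^ 4]. *)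
move=> [_ _ sz mx cA _] fA; pose y := 3 * M + X.
have a0 : 0 < a by case: (posnP a) sz => // ->; rewrite mul0n; lia.
exists (al + y * M); first by rewrite /y; nia.
apply: (@dense_atl _ _ _ y.+1).
  by apply: leq_trans (cA y); rewrite cntT// leq_pmull.
have h1 : al + y * M <= M * y.+1 by rewrite mulnS mulnC leq_add2r; lia.
have h2 : (al + y * M) ^ 2 <= M ^ 2 * y.+1 ^ 2 by rewrite -expnMn leq_exp2r.
have h3 : (3 * M) ^ 2 <= y.+1 ^ 2 by rewrite leq_exp2r// /y; lia.
have h4 : (3 * M) ^ 2 * y.+1 ^ 2 <= y.+1 ^ 2 * y.+1 ^ 2 by rewrite leq_mul2r h3 orbT.
rewrite -expnD -[(2 + 2)]/4 expnMn in h4.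
lia.
Qed.

(** The new digit enlarges only [A]. The sets are then swapped, because the next digit belongs to
    [B]. *)
Lemma level_step A B M a b al be A' B' : level A B M a b al be A' B' ->
  (forall n, A' n) \/
  exists m A'' B'', 1 < m /\
    level B A (m * M) b (m * a) be (al + m.-1 * M) B'' A''.
Proof.
move=> [P' A'1 sz mx cA cB].
have [?|[m [A'' [B'' [m1 P'' B''1 eA eB]]]]] := perfect_decomp P' A'1.
  by left.
have m0 : 0 < m by lia.
right; exists m, A'', B''; split=> //; split=> //.
- exact: perfect_sym.
- by rewrite mulnCA mulnC -sz; lia.
- by rewrite -[in RHS](prednK m0) mulSn -[in RHS]mx; lia.
- move=> y; apply: leq_trans (_ : b * cnt B' (y * m) <= _).
    by rewrite eB cnt_dilate// mulnK.
  by rewrite mulnA.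
- move=> y; apply: leq_trans (_ : a * cnt A' (y * m + m.-1) <= _).
    by rewrite eA cnt_expand_block// mulnCA mulnA.
  apply: leq_trans (cA _) _.
  by rewrite mulnDl mulnA -addnA [_ * M + _]addnC.
Qed.

Lemma level_balanced A B M a b al be A' B' : level A B M a b al be A' B' ->
  3 * al <= M \/ 3 * be <= M -> dense_at A B al \/ dense_at A B be.
Proof.
move=> [P' _ sz mx cA cB] small.
have [A'0 B'0] := perfect0 P'.
have ha : a <= cnt A al.
  by have := cA 0; rewrite mul0n addn0 cnt0 asboolT// muln1.
have hb : b <= cnt B be.
  by have := cB 0; rewrite mul0n addn0 cnt0 asboolT// muln1.
have [h|h] := leqP (9 * al ^ 2) (2 * a ^ 4); first by left; apply: dense_atl h.
have [h'|h'] := leqP (9 * be ^ 2) (2 * b ^ 4).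
  by right; apply/dense_atC/dense_atl/h'.
(* The two failed inequalities are multiplied, using [a * b = M]. *)
have : 2 * M ^ 2 < 9 * (al * be).
  rewrite -(@ltn_exp2r _ _ 2)//.
  have -> : (2 * M ^ 2) ^ 2 = (2 * a ^ 4) * (2 * b ^ 4).
    by rewrite -sz; ring.
  have -> : (9 * (al * be)) ^ 2 = (9 * al ^ 2) * (9 * be ^ 2).
    by ring.
  exact: ltn_mul.
(* Two numbers with sum below [M], one of them at most [M / 3], have product at most
   [(M / 3) * (2 * M / 3)]. *)
suff : 9 * (al * be) <= 2 * M ^ 2 by lia.
rewrite -mx; clear -small mx; rewrite -mx in small.
by rewrite expnS expn1; case: small => ?; nia.
Qed.

(** Two steps restore the order of the sets and increase both maxima, so the dense points found
    later exceed any given [X]. *)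
Lemma level_deep A B : perfect_additive_complements A B -> A 1 ->
  forall X N, (exists2 n, X < n & dense_at A B n) \/
    exists M a b al be A' B', [/\ level A B M a b al be A' B', N <= al & N <= be].
Proof.
move=> AB A1 X; elim=> [|N [|IH]]; [right|by left|].
  exists 1, 1, 1, 0, 0, A, B; split=> //; split=> // y;
  by rewrite mul1n add0n muln1.
move: IH => [M [a [b [al [be [A' [B' [lv alN beN]]]]]]]].
have [/(level_full X lv)|[m [A2 [B2 [m1 lv2]]]]] := level_step lv; first by left.
have [/(level_full X lv2)[n Xn /dense_atC d]|[m' [A3 [B3 [m'1 lv3]]]]] := level_step lv2.
  by left; exists n.
have M0 : 0 < M by have := level_max lv; lia.
right; do 7 eexists; split; first exact: lv3.
  by rewrite -addn1 leq_add// muln_gt0 M0 andbT; lia.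
by rewrite -addn1 leq_add// !muln_gt0 M0 andbT; lia.
Qed.

Lemma perfect_dense_at A B : perfect_additive_complements A B ->
  forall X, exists2 n, X < n & dense_at A B n.
Proof.
move=> AB X; wlog A1 : A B AB / A 1.
  move=> wl; have [a [b [Aa Bb e]]] := perfect_rep 1 AB.
  have [a0|a0] := posnP a.
    have [|n Xn /dense_atC d] := wl _ _ (perfect_sym AB); last by exists n.
    by have -> : 1 = b by lia.
  by apply: wl AB _; have -> : 1 = a by lia.
have [//|[M [a [b [al [be [A' [B' [lv alX beX]]]]]]]]] := level_deep AB A1 X X.+1.
have [sm|big] := leqP (3 * al) M.
  by have [] := level_balanced lv (or_introl sm); [exists al|exists be].
have [/(level_full X lv)//|[m [A2 [B2 [m1 lv2]]]]] := level_step lv.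
(* The step keeps [be] and at least doubles [M], while [3 * al > M] forces [3 * be < 2 * M]. *)
have sm : 3 * be <= m * M by have := level_max lv; nia.
have [/dense_atC d|/dense_atC d] := level_balanced lv2 (or_introl sm).
  by exists be.
by exists (al + m.-1 * M) => //; exact: ltn_addr.
Qed.

(** The extremal complements *)

(** The Moser-de Bruijn sequence 0, 1, 4, 5, 16, ...: sums of distinct powers of 4. *)
Definition even_bits : set nat := [set n | forall k, ~~ odd (n %/ 2 ^ k.*2.+1)].

Lemma even_bitsE : even_bits = block_expand 2 (dilate 2 even_bits).
Proof.
have E k n : n %/ 2 ^ k.+1.*2.+1 = n %/ 2 %/ 2 %/ 2 ^ k.*2.+1.
  by rewrite -!divnMA -!expnS doubleS.
apply/seteqP; split=> n; rewrite /block_expand /dilate/even_bits /=.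
  move=> h; split; first by rewrite dvdn2; exact: (h 0).
  by move=> k; rewrite -E.
move=> [h0 h] [|k]; last by rewrite E.
by rewrite -dvdn2.
Qed.

Lemma even_bits0 : even_bits 0.
Proof. by move=> k; rewrite div0n. Qed.

Lemma perfect_even_bits :
  perfect_additive_complements even_bits (dilate 2 even_bits).
Proof.
move=> n; elim/ltn_ind: n => -[|n] IH.
  exists (0, 0); split=> /=.
    by split=> //; [exact: even_bits0|split=> //; exact: even_bits0].
  by move=> [a b] /= [_ _ e]; congr pair; lia.
rewrite {1}even_bitsE; apply: unique_sum_expand => //.
by apply/unique_sumC/IH; lia.
Qed.

(** Equality holds at [n = 1 + 4 + ... + 4 ^ (k - 1)], where the count is [2 ^ k]. Passing to
    [n %/ 4] at most halves the count, which suffices unless 4 divides [n]. *)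
Lemma cnt_even_bits n : cnt even_bits n ^ 2 <= 3 * n + 1.
Proof.
have ub k : cnt even_bits k <= 2 * cnt even_bits (k %/ 4).
  by rewrite {1}even_bitsE (leq_trans (cnt_expand_le _ _ _))// cnt_dilate// -divnMA.
elim/ltn_ind: n => -[|n] IH; first by rewrite cnt0; case: asbool.
have IH4 : cnt even_bits (n.+1 %/ 4) ^ 2 <= 3 * (n.+1 %/ 4) + 1 by apply: IH; lia.
have n4 := divn_eq n.+1 4.
have [r0|r0] := posnP (n.+1 %% 4); last first.
  have := ub n.+1; rewrite -(@leq_exp2r _ _ 2)// expnMn => h.
  by apply: leq_trans h _; lia.
have [Sn|nSn] := pselect (even_bits n.+1); last first.
  rewrite cntS asboolF// addn0 (leq_trans (IH n _))//; lia.
(* The multiple of 4 [n.+1] is followed by another element with the same quotient by 4, which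
   improves the bound at [n.+1] to [2 * c - 1]. *)
have Sn1 : even_bits n.+2.
  move: Sn; rewrite even_bitsE /block_expand/=.
  by have -> : n.+2 %/ 2 = n.+1 %/ 2 by lia.
have := ub n.+2; rewrite (cntS _ n.+1) (asboolT Sn1).
have -> : n.+2 %/ 4 = n.+1 %/ 4 by lia.
have := cnt_gt0 (n.+1 %/ 4) even_bits0.
move: IH4; set c := cnt _ (_ %/ _); set d := cnt _ _ => IH4 c0 dc.
have : d ^ 2 <= (2 * c - 1) ^ 2 by rewrite leq_exp2r//; lia.
by move: IH4; rewrite !expnS !expn0 !muln1; nia.
Qed.

(** With S for [even_bits], the pair is {0..p-1} + p q S and p {0..q-1} + 2 p q S. *)
Definition extremal1 p q : set nat := block_expand p (dilate q even_bits).
Definition extremal2 p q : set nat :=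
  dilate p (block_expand q (dilate 2 even_bits)).

Lemma perfect_extremal p q : 0 < p -> 0 < q ->
  perfect_additive_complements (extremal1 p q) (extremal2 p q).
Proof.
move=> p0 q0; apply: perfect_expand => //; apply/perfect_sym/perfect_expand => //.
exact/perfect_sym/perfect_even_bits.
Qed.

Lemma cnt_extremal1 p q n : 0 < p -> 0 < q ->
  q * cnt (extremal1 p q) n ^ 2 <= 3 * p * n + q * p ^ 2.
Proof.
move=> p0 q0; have h : cnt (extremal1 p q) n <= p * cnt even_bits (n %/ (p * q)).
  by rewrite (leq_trans (cnt_expand_le _ _ _))// cnt_dilate// divnMA.
move: h; rewrite -(@leq_exp2r _ _ 2)// expnMn => h.
have := cnt_even_bits (n %/ (p * q)).
have := leq_trunc_div n (p * q).
set k := n %/ _; set c := cnt even_bits k in h * => kn cb.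
apply: leq_trans (_ : q * (p ^ 2 * (3 * k + 1)) <= _).
  by rewrite leq_mul2l (leq_trans h) ?orbT// leq_mul2l cb orbT.
have -> : q * (p ^ 2 * (3 * k + 1)) = 3 * p * (k * (p * q)) + q * p ^ 2 by ring.
by rewrite leq_add2r leq_mul2l kn orbT.
Qed.

Lemma cnt_extremal2 p q n : 0 < p -> 0 < q ->
  2 * p * cnt (extremal2 p q) n ^ 2 <= 3 * q * n + 2 * p * q ^ 2.
Proof.
move=> p0 q0.
have h : cnt (extremal2 p q) n <= q * cnt even_bits (n %/ (p * q * 2)).
  by rewrite cnt_dilate// (leq_trans (cnt_expand_le _ _ _))// cnt_dilate// !divnMA.
move: h; rewrite -(@leq_exp2r _ _ 2)// expnMn => h.
have := cnt_even_bits (n %/ (p * q * 2)).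
have := leq_trunc_div n (p * q * 2).
set k := n %/ _; set c := cnt even_bits k in h * => kn cb.
apply: leq_trans (_ : 2 * p * (q ^ 2 * (3 * k + 1)) <= _).
  by rewrite leq_mul2l (leq_trans h) ?orbT// leq_mul2l cb orbT.
have -> : 2 * p * (q ^ 2 * (3 * k + 1)) =
  3 * q * (k * (p * q * 2)) + 2 * p * q ^ 2 by ring.
by rewrite leq_add2r leq_mul2l kn orbT.
Qed.

(** The limit superior *)

Local Open Scope ring_scope.

Lemma counting_functionE (R : realType) (A : set nat) (x : R) : 0 <= x ->
  counting_function A x = cnt A (Num.truncn x).
Proof.
move=> x0; set n := Num.truncn x; rewrite /counting_function.
pose s := [seq i <- iota 0 n.+1 | `[< A i >]].
have -> : [set a | A a /\ a%:R <= x] = [set` [fset i in s]%fset].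
  apply/seteqP; split=> i /=; rewrite !inE mem_filter mem_iota add0n ltnS leq0n/=.
    by move=> [Ai ix]; rewrite asboolT//= truncn_ge_nat.
  by move=> /andP[/asboolP Ai]; rewrite truncn_ge_nat.
rewrite set_fsetK card_fseq undup_id ?filter_uniq ?iota_uniq// size_filter.
rewrite /cnt -(big_mkord xpredT (fun i => nat_of_bool `[< A i >])).
by rewrite -sum1_count big_mkcond/= /index_iota subn0; apply: eq_bigr => i _; case: asbool.
Qed.

Lemma SX_ge (R : realType) (A B : set nat) :
  perfect_additive_complements A B -> (((9 / 2 : R) `^ (1 / 4))%:E <= SX R A B)%E.
Proof.
(* Every neighbourhood of infinity contains a dense integer, which bounds the supremum there from
   below. *)
move=> AB; apply: le_ereal_inf_tmp => _ [V [X [_ XV]] <-].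
have [n Xn dn] := perfect_dense_at AB (Num.truncn X).
have nX : X < n%:R.
  by rewrite (lt_le_trans (truncnS_gt _))// ler_nat.
have n0 : (0 : R) < n%:R by rewrite ltr0n; lia.
apply: le_trans (ereal_sup_ubound _); last by exists n%:R => //; exact: XV.
rewrite lee_fin !counting_functionE ?ler0n// natrK.
set m := maxn _ _; have {}dn : (9 * n ^ 2 <= 2 * m ^ 4)%N := dn.
have sn : 0 < Num.sqrt (n%:R : R) by rewrite sqrtr_gt0.
have h : (9 / 2 : R) <= (m%:R / Num.sqrt n%:R) ^+ 4.
  have -> : (m%:R / Num.sqrt (n%:R : R)) ^+ 4 = m%:R ^+ 4 / n%:R ^+ 2.
    by rewrite expr_div_n -{2}[4%N]/(2 * 2)%N exprM sqr_sqrtr// ltW.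
  rewrite ler_pdivlMr ?exprn_gt0//.
  move: dn; rewrite -(ler_nat R) (natrM _ 9) (natrM _ 2) !natrX; lra.
have f0 : 0 <= m%:R / Num.sqrt (n%:R : R) by rewrite divr_ge0// ltW.
apply: le_trans (_ : ((m%:R / Num.sqrt n%:R) ^+ 4) `^ (1 / 4) <= _).
  by apply: ge0_ler_powR; rewrite ?nnegrE ?exprn_ge0// divr_ge0.
by rewrite -powR_mulrn// -powRrM mul1r divff// powRr1.
Qed.

Lemma SX_le (R : realType) (A B : set nat) (c X : R) : 0 <= c -> 0 <= X ->
  (forall n : nat, forall x : R, X < x -> n%:R <= x ->
    (cnt A n)%:R ^+ 2 <= c ^+ 2 * x /\ (cnt B n)%:R ^+ 2 <= c ^+ 2 * x) ->
  (SX R A B <= c%:E)%E.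
Proof.
move=> c0 X0 h; apply: le_trans (ereal_inf_lbound _) _.
  exists [set x | X < x] => //=; exists X; split=> //; exact: num_real.
apply: ge_ereal_sup => _ [x /= Xx <-].
have x0 : 0 < x by apply: le_lt_trans Xx.
have sx : 0 < Num.sqrt x by rewrite sqrtr_gt0.
rewrite lee_fin ler_pdivrMr// !(counting_functionE _ (ltW x0)).
rewrite -ler_sqr ?nnegrE ?mulr_ge0// ?(ltW sx)//.
rewrite exprMn sqr_sqrtr ?(ltW x0)//.
have [hA hB] := h (Num.truncn x) x Xx (etrans (truncn_le _) (ltW x0)).
by rewrite /maxn; case: ifP.
Qed.

Lemma exists_extremal (R : realType) (c : R) : 0 < c -> 9 / 2 < c ^+ 4 ->
  exists2 p, perfect_additive_complements p.1 p.2 & (SX R p.1 p.2 <= c%:E)%E.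
Proof.
move=> c0 c4; have t0 : 0 < c ^+ 2 by rewrite exprn_gt0.
set t := c ^+ 2 in t0; have {}c4 : 9 / 2 < t ^+ 2 by rewrite -exprM.
(* The slopes [3 * p / q] and [3 * q / (2 * p)] are both below [t] exactly when [p / q] lies in this
   interval. *)
have : 3 / 2 / t < t / 3.
  by rewrite ltr_pdivrMr// mulrAC ltr_pdivlMr// -expr2; lra.
move=> /rat_in_itvoo[r]; rewrite in_itv/= => /andP[r1 r2].
have r0 : (0 : R) < ratr r by apply: lt_trans r1; rewrite divr_gt0.
have : exists p q : nat, [/\ (0 < p)%N, (0 < q)%N & ratr r = p%:R / q%:R :> R].
  rewrite ltr0q in r0; exists `|numq r|%N, `|denq r|%N; split.
  - by rewrite absz_gt0 numq_eq0 gt_eqF.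
  - by rewrite absz_gt0 denq_neq0.
  - by rewrite /ratr !natr_absz !gtr0_norm ?numq_gt0.
move=> [p [q [p0 q0 rE]]].
have P0 : (0 : R) < p%:R by rewrite ltr0n.
have Q0 : (0 : R) < q%:R by rewrite ltr0n.
rewrite rE ltr_pdivlMr// mulrAC ltr_pdivrMr// in r1.
rewrite rE ltr_pdivrMr// mulrAC ltr_pdivlMr// in r2.
exists (extremal1 p q, extremal2 p q); first exact: perfect_extremal.
pose d1 : R := t * q%:R - 3 * p%:R; pose d2 : R := 2 * p%:R * t - 3 * q%:R.
have d10 : 0 < d1 by rewrite /d1; lra.
have d20 : 0 < d2 by rewrite /d2; lra.
(* Beyond [X], the slacks [d1 * x] and [d2 * x] absorb the constant terms of the two counting
   bounds. *)
pose X := q%:R * p%:R ^+ 2 / d1 + 2 * p%:R * q%:R ^+ 2 / d2.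
have X10 : 0 <= q%:R * p%:R ^+ 2 / d1.
  by rewrite divr_ge0 ?(ltW d10)// mulr_ge0 ?exprn_ge0.
have X20 : 0 <= 2 * p%:R * q%:R ^+ 2 / d2.
  by rewrite divr_ge0 ?(ltW d20)// !mulr_ge0 ?exprn_ge0.
apply: (@SX_le _ _ _ _ X); [exact: ltW|by rewrite addr_ge0|].
move=> n x Xx nx; split.
  have : q%:R * p%:R ^+ 2 / d1 <= x by rewrite /X in Xx; lra.
  rewrite ler_pdivrMr// => h.
  have := cnt_extremal1 n p0 q0; rewrite -(ler_nat R) natrD !natrM -!expr2 => hc.
  have h' : 3 * p%:R * n%:R <= 3 * p%:R * x by rewrite ler_wpM2l// mulr_ge0.
  rewrite -/t -(ler_pM2l Q0) (le_trans hc)//; rewrite /d1 in h; lra.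
have : 2 * p%:R * q%:R ^+ 2 / d2 <= x by rewrite /X in Xx; lra.
rewrite ler_pdivrMr// => h.
have := cnt_extremal2 n p0 q0; rewrite -(ler_nat R) natrD !natrM -!expr2 => hc.
have h' : 3 * q%:R * n%:R <= 3 * q%:R * x by rewrite ler_wpM2l// mulr_ge0.
have P20 : (0 : R) < 2 * p%:R by rewrite mulr_gt0.
rewrite -/t -(ler_pM2l P20) (le_trans hc)//; rewrite /d2 in h; lra.
Qed.

Theorem theorem4 (R : realType) :
  ereal_inf [set SX R p.1 p.2 | p in
    [set p : set nat * set nat | perfect_additive_complements p.1 p.2]]
  = ((9 / 2 : R) `^ (1 / 4))%:E.
Proof.
apply/eqP; rewrite eq_le; apply/andP; split; last first.
  by apply: le_ereal_inf_tmp => _ [[A B] /= AB <-]; exact: SX_ge.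
(* A positive margin [e] leaves room for a rational [p / q]. *)
apply/lee_addgt0Pr => e e0; set c := _ `^ _; rewrite -EFinD.
have c0 : 0 < c by rewrite powR_gt0.
have c4 : c ^+ 4 = 9 / 2.
  by rewrite -powR_mulrn ?ltW// -powRrM mul1r mulVf// powRr1.
have [||p pp hp] := @exists_extremal R (c + e); first by rewrite addr_gt0.
  by rewrite -c4 ltr_pXn2r// ?nnegrE ?ltW ?addr_gt0// ltrDl.
by apply: le_trans hp; apply: ereal_inf_lbound; exists p.
Qed.
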